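(* There exists a set $Z\subset\mathbb{T}^2$ of full Lebesgue measure such that for every $(\alpha,\beta)\in Z$ we have, for Lebesgue-a.e. $x\in\mathbb{T}$, $$\limsup_{N\to\infty}\Theta_N^\beta(x)=\infty\qquad\text{and}\qquad\liminf_{N\to\infty}\Theta_N^\beta(x)=0,$$ where $$\Theta_N^\beta(x)=\frac{S_N(\phi)(x)}{S_N(\phi)(x-\beta)},\qquad \phi(x)=\frac1x+\frac1{1-x}.$$
   Context: $\mathbb{T}=\mathbb{R}/\mathbb{Z}$, identified with $[0,1)$; $R_\alpha(x)=x+\alpha\bmod1$ is the rotation by $\alpha$ on $\mathbb{T}$. The function $\phi$ is given by the stated formula for $x\in(0,1)$ (its value at $0$ is irrelevant for almost everywhere statements), and $S_N(\phi)(x)=\sum_{k=0}^{N-1}\phi(R_\alpha^k x)$; thus $\Theta_N^\beta$ also depends on $\alpha$. The argument $x-\beta$ is taken modulo $1$. *)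

(* Defs.v *)
From mathcomp Require Import all_boot all_order all_algebra.
From mathcomp Require Import all_classical all_reals all_analysis.

Set Implicit Arguments.
Unset Strict Implicit.
Unset Printing Implicit Defensive.

Import Order.TTheory GRing.Theory Num.Theory.
Import numFieldNormedType.Exports.

Local Open Scope classical_set_scope.
Local Open Scope ring_scope.

(* The circle R/Z is represented by its fundamental domain [0, 1); points are
   reduced to it with [mod1]. *)
Definition circle (R : realType) : set R := `[0, 1[.

Definition mod1 (R : realType) (x : R) : R := x - (Num.floor x)%:~R.

Definition rotation (R : realType) (alpha x : R) : R := mod1 (x + alpha).

Definition birkhoff_sum (R : realType) (T : R -> R) (f : R -> R) (N : nat)
    (x : R) : R :=
  \sum_(k < N) f (iter k T x).

(* Used on (0, 1); since 0^-1 = 0, the value at 0 is the junk value 1. *)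
Definition phi (R : realType) (x : R) : R := x^-1 + (1 - x)^-1.

Definition Theta (R : realType) (alpha beta : R) (N : nat) (x : R) : R :=
  birkhoff_sum (rotation alpha) (@phi R) N x /
  birkhoff_sum (rotation alpha) (@phi R) N (mod1 (x - beta)).

(* Main.v *)
(* Let S_N denote the Birkhoff sums of phi. For almost every (alpha, x), pairwise
   independence of the positions x + k alpha and the second Borel-Cantelli lemma
   give, for every m, infinitely many k with 0 < x + k alpha < 1/(4^m j 2^j)
   modulo 1, where 2^(j-1) <= k < 2^j; then S_(k+1)(x) >= 4^m j 2^j. On the other
   hand, a truncation of phi and Markov's inequality show that
   S_(k+1)(y) <= 2^m j 2^j for y outside a set of measure O(2^-m). Hence
   S_N(x)/S_N(y) is unbounded for almost every (alpha, x, y), and so is its inverse;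
   it remains to substitute y = x - beta. *)
Require Import Defs.
From HB Require Import structures.
From mathcomp Require Import all_boot all_order all_algebra.
From mathcomp Require Import all_classical all_reals all_analysis.
From mathcomp Require Import measurable_realfun ring lra.

Import Order.TTheory GRing.Theory Num.Theory.
Import numFieldNormedType.Exports.

Local Open Scope classical_set_scope.
Local Open Scope ring_scope.

(** * Lebesgue measure on the circle and its invariance *)

Section Circle.
Context {R : realType}.
Implicit Types (x y a c : R) (A B : set R).
Local Notation leb := (@lebesgue_measure R).

Lemma mod1_ge0 x : 0 <= mod1 x.
Proof. by rewrite subr_ge0 floor_le_tmp. Qed.

Lemma mod1_lt1 x : mod1 x < 1.
Proof.
by rewrite /mod1 ltrBlDr addrC -[1]/(1%:~R) -intrD floorD1_gt.
Qed.

Lemma mod1_id x : 0 <= x -> x < 1 -> mod1 x = x.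
Proof.
move=> x0 x1; rewrite /mod1 (_ : Num.floor x = 0) ?subr0//.
by apply: floor_def; rewrite add0r x0 x1.
Qed.

Lemma mod1Dz x (n : int) : mod1 (x + n%:~R) = mod1 x.
Proof.
by rewrite /mod1 floorDrz ?intr_int// intrKfloor intrD opprD addrACA subrr addr0.
Qed.

Lemma mod1Dl x y : mod1 (mod1 x + y) = mod1 (x + y).
Proof. by rewrite -(mod1Dz (x + y) (- Num.floor x)) intrN addrAC. Qed.

Lemma measurable_mod1 : measurable_fun setT (@mod1 R).
Proof.
apply: measurable_funB => //.
by apply: nondecreasing_measurable => // x y xy; rewrite ler_int le_floor.
Qed.

Let shift c : measurableTypeR R -> measurableTypeR R := fun x => x + c.

Let measurable_shift c : measurable_fun setT (shift c).
Proof. exact: measurable_funD. Qed.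

HB.instance Definition _ c :=
  isMeasurableFun.Build _ _ _ _ (shift c) (measurable_shift c).

(** The pushforward under a translation agrees with Lebesgue measure on half-open intervals, and
    these values determine the measure. *)
Lemma lebesgue_measure_shift c A : measurable A ->
  leb ((fun x => x + c) @^-1` A) = leb A.
Proof.
move=> mA; rewrite -[LHS]/(pushforward leb (shift c) A).
apply/esym/lebesgue_measure_unique => //= _ [[a b]] _ <-.
rewrite /pushforward /shift /=.
have -> : (fun x => x + c) @^-1` `]a, b] = `]a - c, b - c]%classic.
  by apply/seteqP; split => x /=; rewrite !in_itv/= ltrBlDr lerBrDr.
rewrite !lebesgue_measure_itv/= !lte_fin ltrD2r.
by case: ifP => // _; rewrite -EFinB; congr EFin; lra.
Qed.

(** An integer translation moves c to its fractional part t; the window [t, t + 1) is cut at 1, and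
    its right piece goes back by 1 onto [0, t). *)
Lemma lebesgue_measure_periodic c B : measurable B ->
  (forall x, B (x + 1) <-> B x) ->
  leb (B `&` `[c, c + 1[) = leb (B `&` `[0, 1[).
Proof.
move=> mB pB; pose n := Num.floor c; pose t : R := c - n%:~R.
have pBz (m : nat) x : B (x + m%:R) <-> B x.
  by elim: m => [|m <-]; rewrite ?addr0// -natr1 addrA pB.
have pBn x : B (x + n%:~R) <-> B x.
  case: (n) => m; first exact: pBz.
  by rewrite NegzE intrN -(pBz m.+1 (x - _)) subrK.
have t0 : 0 <= t by exact: mod1_ge0.
have t1 : t < 1 by exact: mod1_lt1.
have mI (i : interval R) : measurable (B `&` [set` i]) by exact: measurableI.
rewrite -[LHS](lebesgue_measure_shift n%:~R)//.
have -> : (fun x => x + n%:~R) @^-1` (B `&` `[c, c + 1[) =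
    (B `&` `[t, 1[) `|` (B `&` `[1, t + 1[).
  apply/seteqP; split => [x [/= /pBn Bx]|x /=].
    rewrite in_itv/= => /andP[h1 h2]; have [x1|x1] := ltP x 1; [left|right].
      by split => //; rewrite /= in_itv/= x1 andbT /t; lra.
    by split => //; rewrite /= in_itv/= x1 /t /=; lra.
  move=> [] [/pBn Bx]; rewrite !in_itv/= => /andP[h1 h2]; split => //;
    move: h1 h2 t0 t1; rewrite /t; lra.
rewrite measureU//=; try exact: mI; last first.
  rewrite setIACA setIid (_ : `[t, 1[ `&` `[1, t + 1[ = set0) ?setI0//.
  by apply/seteqP; split => x //= []; rewrite !in_itv/=; lra.
rewrite -[X in (_ + X)%E](lebesgue_measure_shift 1) /=; last exact: mI.
have -> : (fun x => x + 1) @^-1` (B `&` `[1, t + 1[) = B `&` `[0, t[.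
  apply/seteqP; split => x /=; rewrite !in_itv/= pB => -[Bx h]; split => //; lra.
rewrite -measureU//=; try exact: mI; last first.
  rewrite setIACA setIid (_ : _ `&` _ = set0) ?setI0//.
  by apply/seteqP; split => x //= []; rewrite !in_itv/=; lra.
congr (leb _); rewrite -setIUr; congr (_ `&` _).
apply/seteqP; split => x /=; rewrite !in_itv/=.
  by case; lra.
by have [?|?] := ltP x t; [right|left]; lra.
Qed.

(** A measure on the whole line with no mass outside [0, 1), so that the circle needs no type of its
    own. *)
Definition circle_measure := mrestr leb (measurable_itv `[(0:R), 1[).

HB.instance Definition _ := Measure.on circle_measure.

Lemma circle_measure_setT : circle_measure setT = 1%E.
Proof.
rewrite /circle_measure /mrestr setTI lebesgue_measure_itv/=.
by rewrite lte_fin ltr01 -EFinB subr0.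
Qed.

HB.instance Definition _ :=
  Measure_isProbability.Build _ _ _ circle_measure circle_measure_setT.

Local Notation nu := circle_measure.

(** Translation by a carries [0, 1) to [a, a + 1), and a preimage under [mod1] is 1-periodic, so it
    has the same mass in both windows. *)
Lemma circle_measure_rotation a A : measurable A ->
  nu ((fun y => mod1 (y + a)) @^-1` A) = nu A.
Proof.
move=> mA; rewrite /nu /mrestr.
have mB : measurable (@mod1 R @^-1` A).
  by rewrite -[X in measurable X]setTI; exact: measurable_mod1.
rewrite [RHS](_ : _ = leb (@mod1 R @^-1` A `&` `[0, 1[)); last first.
  congr (leb _); apply/seteqP; split => x /= []; rewrite in_itv/= => Ax /andP[x0 x1];
  split; rewrite ?in_itv/= ?x0//; move: Ax; by rewrite /= mod1_id.
rewrite -(@lebesgue_measure_periodic a)//; last first.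
  by move=> x /=; rewrite -[1]/(1%:~R) mod1Dz.
rewrite -[RHS](lebesgue_measure_shift a)//; last exact: measurableI.
congr (leb _); apply/seteqP; split => x /=; rewrite !in_itv/= => -[? ?]; split => //; lra.
Qed.

(** A reflection is a negation followed by a rotation. Negation sends [0, 1) to (-1, 0], which
    differs from the period window [-1, 0) only by its null endpoints. *)
Lemma circle_measure_reflection a A : measurable A ->
  nu ((fun y => mod1 (a - y)) @^-1` A) = nu A.
Proof.
move=> mA; rewrite -(@circle_measure_rotation a A)// /nu /mrestr.
pose B := (fun y => mod1 (y + a)) @^-1` A.
have mB : measurable B.
  rewrite -[B]setTI; apply: (measurableT_comp measurable_mod1) => //.
  exact: measurable_funD.
have mN : measurable_fun setT (-%R : measurableTypeR R -> measurableTypeR R).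
  exact: oppr_measurable.
rewrite -/B -[RHS](@lebesgue_measure_periodic (-1))//; last first.
  by move=> x; rewrite /B /= addrAC -[1]/(1%:~R) mod1Dz.
have -> : (fun y => mod1 (a - y)) @^-1` A `&` `[0, 1[ = -%R @^-1` (B `&` `]-1, 0]).
  apply/seteqP; split => x /=; rewrite !in_itv/= /B /= addrC => -[? ?]; split => //; lra.
rewrite -[LHS]/(pushforward leb (-%R : _ -> measurableTypeR R) (B `&` `]-1, 0])).
rewrite lebesgue_measureN; last exact: measurableI.
have H b1 b2 : leb (B `&` [set` Interval (BSide b1 (-1)) (BSide b2 0)]) =
    leb (B `&` `]-1, 0[).
  apply/eqP; rewrite eq_le; apply/andP; split; last first.
    apply: le_measure; rewrite ?inE; try exact: measurableI.
    apply: setIS => x /=; rewrite !in_itv/=; case: b1 b2 => -[] /=; lra.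
  apply: (@le_trans _ _ (leb ((B `&` `]-1, 0[) `|` [set -1] `|` [set 0]))).
    apply: le_measure; rewrite ?inE; try exact: measurableI.
      by do 2 apply: measurableU => //; exact: measurableI.
    move=> x /= [Bx]; rewrite !in_itv/= => h.
    have [->|n0] := eqVneq x 0; first by right.
    have [->|n1] := eqVneq x (-1); first by left; right.
    left; left; split=> //; rewrite !lt_neqAle n0 (eq_sym _ x) n1 /=.
    by move: h; case: (b1) (b2) => -[] /=; lra.
  rewrite measureU0//; first rewrite measureU0//.
  - exact: measurableI.
  - exact: lebesgue_measure_set1.
  - by apply: measurableU => //; exact: measurableI.
  - exact: lebesgue_measure_set1.
by rewrite H addNr H.
Qed.

End Circle.

Arguments circle_measure : clear implicits.

(** Both iterated integrals agree on rectangles, hence everywhere; this allows sections in either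
    variable to be used. *)
Lemma product_measure12 d1 d2 (T1 : measurableType d1) (T2 : measurableType d2)
    (R : realType) (m1 : {sigma_finite_measure set T1 -> \bar R})
    (m2 : {sigma_finite_measure set T2 -> \bar R}) (X : set (T1 * T2)) :
  measurable X -> ((m1 \x m2) X = (m1 \x^ m2) X)%E.
Proof.
move=> mX.
by apply: product_measure_unique => //= A B mA mB; rewrite product_measure2E.
Qed.

(** * Uniform distribution and pairwise independence of the points x + k alpha *)

Section TorusOrbit.
Context {R : realType}.
Implicit Types (x y al : R) (A B : set R) (k l m n : nat).
Local Notation nu := (circle_measure R).
Local Notation nu2 := (circle_measure R \x circle_measure R)%E.

Lemma mod1Ml n x : mod1 (n%:R * mod1 x) = mod1 (n%:R * x).
Proof.
rewrite {2}/mod1 mulrBr -(mod1Dz (n%:R * x) (- (n%:Z * Num.floor x))).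
by rewrite intrN intrM.
Qed.

Lemma iter_rotation al k x : 0 <= x -> x < 1 ->
  iter k (rotation al) x = mod1 (x + k%:R * al).
Proof.
move=> x0 x1; elim: k => [|k IH]; first by rewrite mul0r addr0 mod1_id.
by rewrite iterS IH /rotation mod1Dl -natr1 mulrDl mul1r addrA.
Qed.

(** Pairs are ordered (alpha, x): the angle first, the starting point second. *)
Definition orbit_in k A : set (R * R) :=
  [set z | A (mod1 (z.2 + k%:R * z.1))].

Lemma measurable_orbit k :
  measurable_fun setT (fun z : R * R => mod1 (z.2 + k%:R * z.1)).
Proof.
apply: measurableT_comp; first exact: measurable_mod1.
by apply: measurable_funD => //; exact: measurable_funM.
Qed.

Lemma measurable_orbit_in k A : measurable A -> measurable (orbit_in k A).
Proof.
by move=> mA; rewrite -[X in measurable X]setTI; exact: measurable_orbit.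
Qed.

(** For fixed alpha the section in x is a rotated copy of A. *)
Lemma orbit_in_measure k A : measurable A -> nu2 (orbit_in k A) = nu A.
Proof.
move=> mA; rewrite /product_measure1 (eq_integral (cst (nu A))).
  by rewrite integral_cst//= circle_measure_setT mule1.
move=> al _ /=; rewrite -(@circle_measure_rotation _ (k%:R * al) A)//; congr (nu _).
by apply/seteqP; split => x /=; rewrite /xsection /orbit_in /= inE.
Qed.

(** Rotating alpha by y / n shows that the left side does not depend on y; its average over y is a
    measure on the torus, which [orbit_in_measure] evaluates. *)
Lemma circle_measure_affine n y B : (0 < n)%N -> measurable B ->
  nu [set al | B (mod1 (y + n%:R * al))] = nu B.
Proof.
move=> n0 mB; have nR : n%:R != 0 :> R by rewrite pnatr_eq0 -lt0n.
have mS z : measurable [set al | B (mod1 (z + n%:R * al))].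
  rewrite -[X in measurable X]setTI.
  have mf : measurable_fun setT (fun al => mod1 (z + n%:R * al)).
    apply: measurableT_comp; first exact: measurable_mod1.
    by apply: measurable_funD => //; exact: measurable_funM.
  exact: mf.
have cst_nu z : nu [set al | B (mod1 (z + n%:R * al))] =
    nu [set al | B (mod1 (0 + n%:R * al))].
  rewrite -(@circle_measure_rotation _ (z / n%:R) _ (mS 0)); congr (nu _).
  apply/seteqP; split => al /=;
    by rewrite add0r mod1Ml mulrDr mulrCA divff// mulr1 addrC.
rewrite cst_nu -[RHS](@orbit_in_measure n)//.
rewrite product_measure12; last exact: measurable_orbit_in.
rewrite /product_measure2 (eq_integral (cst (nu [set al | B (mod1 (0 + n%:R * al))]))).
  by rewrite integral_cst//= circle_measure_setT mule1.
move=> z _ /=; rewrite -(cst_nu z); congr (nu _).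
by apply/seteqP; split => x /=; rewrite /ysection /orbit_in /= inE.
Qed.

(* Passing from x to y = x + k alpha reduces the pair (k, l) to (0, l - k). *)
Lemma orbit_in_indep k l A B : (k < l)%N -> measurable A -> measurable B ->
  nu2 (orbit_in k A `&` orbit_in l B) = (nu A * nu B)%E.
Proof.
move=> kl mA mB; pose D : set (R * R) := (setT `*` A) `&` orbit_in (l - k) B.
have mD : measurable D.
  by apply: measurableI; [exact: measurableX|exact: measurable_orbit_in].
transitivity (nu2 D).
  rewrite /product_measure1; apply: eq_integral => al _ /=.
  rewrite -(@circle_measure_rotation _ (k%:R * al) (xsection D al)); last first.
    exact: measurable_xsection.
  congr (nu _); apply/seteqP; split => x /=;
    rewrite /xsection /D /orbit_in /= !inE /= ?inE mod1Dl -addrA -mulrDl -natrD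
      subnKC 1?ltnW//; tauto.
rewrite product_measure12// /product_measure2.
(* The section in alpha over y is empty unless y lies in A, and then has measure [nu B] because
   alpha is multiplied by l - k > 0. *)
rewrite (eq_integral (fun y : measurableTypeR R => nu B * (\1_A y)%:E)%E); last first.
  move=> y _ /=; rewrite indicE; have [yA|yA] := boolP (y \in A).
    rewrite mule1 -(@circle_measure_affine (l - k) y B) ?subn_gt0//; congr (nu _).
    apply/seteqP; split => al /=; rewrite /ysection /D /orbit_in /= !inE /=.
      by case.
    by move=> ?; split => //; split=> //; exact: set_mem.
  rewrite mule0 (_ : ysection D y = set0) ?measure0//; apply/seteqP; split => // al.
  rewrite /ysection /D /= inE => -[[_ Ay] _].
  by move: yA; rewrite (mem_set Ay).
rewrite ge0_integralZl ?integral_indic ?setIT//=; first by rewrite muleC.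
- exact: measurableT_comp.
Qed.

End TorusOrbit.

(** * The second Borel-Cantelli lemma for pairwise independent events *)

Section BorelCantelli.
Context d (T : measurableType d) {R : realType} (P : probability T R).
Local Open Scope ereal_scope.

Lemma integral_sum_indic (I : finType) (a : I -> R) (A : I -> set T) :
  (forall i, 0 <= a i)%R -> (forall i, measurable (A i)) ->
  \int[P]_x (\sum_i a i * \1_(A i) x)%R%:E = \sum_i (a i)%:E * P (A i).
Proof.
move=> a0 mA; under eq_integral do rewrite -sumEFin.
rewrite ge0_integral_sum//; last 2 first.
- move=> i; apply/measurable_EFinP/measurable_funM => //; exact: measurable_indic.
- by move=> i x _; rewrite lee_fin mulr_ge0.
apply: eq_bigr => i _; under eq_integral do rewrite EFinM.
rewrite ge0_integralZl//; first by rewrite integral_indic// setIT.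
- by apply/measurable_EFinP; exact: measurable_indic.
- by rewrite lee_fin.
Qed.

Variables (E : nat -> set T) (p : nat -> R).
Hypothesis mE : forall i, measurable (E i).
Hypothesis PE : forall i, P (E i) = (p i)%:E.
Hypothesis indepE : forall i j, (i < j)%N -> P (E i `&` E j) = P (E i) * P (E j).

Let Z := \bigcap_i ~` E i.

Let mZ : measurable Z.
Proof. by apply: bigcapT_measurable => i; exact: measurableC. Qed.

Let p_ge0 i : (0 <= p i)%R.
Proof. by rewrite -lee_fin -PE. Qed.

Let X n x : R := (\sum_(i < n) \1_(E i) x)%R.

Let mX n : measurable_fun setT (X n).
Proof. by apply: measurable_sum => i; exact: measurable_indic. Qed.

(* The second moment of the counting function X minus its mean s is at most s. *)
Let no_event_le n (s := (\sum_(i < n) p i)%R) : s%:E * (s%:E * P Z) <= s%:E.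
Proof.
have s0 : (0 <= s)%R by apply: sumr_ge0.
have X0 x : (0 <= X n x)%R by apply: sumr_ge0.
have intX : \int[P]_x (X n x)%:E = s%:E.
  transitivity (\int[P]_x (\sum_(i < n) 1 * \1_(E i) x)%R%:E).
    by apply: eq_integral => x _; congr EFin; apply: eq_bigr => i _; rewrite mul1r.
  rewrite integral_sum_indic// /s -sumEFin; apply: eq_bigr => i _.
  by rewrite mul1e PE.
(* Diagonal pairs contribute s in total; the other pairs contribute at most s^2 by pairwise
   independence. *)
have intX2 : \int[P]_x (X n x ^+ 2)%:E <= (s + s ^+ 2)%:E.
  rewrite (_ : \int[P]_x _ =
      \int[P]_x (\sum_(z : 'I_n * 'I_n) 1 * \1_(E z.1 `&` E z.2) x)%R%:E); last first.
    apply: eq_integral => x _; congr EFin.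
    rewrite expr2 /X big_distrlr pair_bigA; apply: eq_bigr => z _ /=.
    by rewrite mul1r indicI.
  rewrite integral_sum_indic//; last by move=> i; exact: measurableI.
  rewrite -(pair_bigA _ (fun i j : 'I_n => 1%:E * P (E i `&` E j))) /=.
  rewrite /s expr2 big_distrlr /= -big_split /= -sumEFin.
  apply: lee_sum => i _; rewrite (bigD1 i)//= [in leRHS](bigD1 i)//= mul1e setIid.
  rewrite EFinD PE leeD2l// EFinD addeC -[leLHS]adde0 leeD ?lee_fin ?mulr_ge0//.
  rewrite -sumEFin; apply: lee_sum => j ij; rewrite mul1e.
  have [lt|] := ltnP i j; first by rewrite indepE// !PE.
  by rewrite leq_eqVlt val_eqE (negbTE ij) /= setIC => lt; rewrite indepE// !PE mulrC.
(* This is s^2 1_Z <= (X - s)^2, valid since X = 0 on Z, rearranged so that both integrands are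
   nonnegative. *)
have : \int[P]_x (s ^+ 2 * \1_Z x + (s + s) * X n x)%:E <=
       \int[P]_x (X n x ^+ 2 + s ^+ 2)%:E.
  apply: ge0_le_integral => //.
  - by move=> x _; rewrite lee_fin addr_ge0// mulr_ge0// ?sqr_ge0// addr_ge0.
  - apply/measurable_EFinP/measurable_funD; apply: measurable_funM => //.
  - apply/measurable_EFinP/measurable_funD => //; exact: measurable_funX.
  - move=> x _; rewrite lee_fin indicE; have [/set_mem Zx|_] := boolP (x \in Z).
      rewrite (_ : X n x = 0%R) ?mulr0 ?addr0 ?mulr1 ?expr0n ?add0r//.
      by apply: big1 => i _; rewrite indicE memNset//; exact: Zx.
    rewrite mulr0 add0r; have := sqr_ge0 (X n x - s)%R; rewrite sqrrB; nra.
under eq_integral do rewrite EFinD EFinM [X in _ + X]EFinM.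
rewrite ge0_integralD//; last 4 first.
- by move=> x _; rewrite mule_ge0// lee_fin sqr_ge0.
- by apply: emeasurable_funM => //; apply/measurable_EFinP.
- by move=> x _; rewrite mule_ge0// lee_fin// addr_ge0.
- by apply: emeasurable_funM => //; apply/measurable_EFinP.
rewrite !ge0_integralZl//=; last 5 first.
- by apply/measurable_EFinP.
- by move=> x _; rewrite lee_fin.
- by rewrite lee_fin addr_ge0.
- by apply/measurable_EFinP.
- by rewrite lee_fin sqr_ge0.
rewrite intX integral_indic// setIT.
under [in X in _ <= X]eq_integral do rewrite EFinD.
rewrite ge0_integralD//; last 3 first.
- by move=> x _; rewrite lee_fin sqr_ge0.
- by apply/measurable_EFinP; exact: measurable_funX.
- by move=> x _; rewrite lee_fin sqr_ge0.
rewrite integral_cst//= [P setT]probability_setT mule1.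
move/le_trans => /(_ _ (leeD2r _ intX2)).
rewrite -(@fineK _ (P Z)) ?fin_num_measure// -!EFinM -!EFinD !lee_fin; nra.
Qed.

(** By [no_event_le], the probability that no event occurs is at most 1/s for every positive partial
    sum s. *)
Lemma pairwise_borel_cantelli :
  (forall M : R, exists n, M <= \sum_(i < n) p i)%R -> P (\bigcap_i ~` E i) = 0.
Proof.
move=> ubd; rewrite -/Z; apply/eqP; rewrite eq_le measure_ge0 andbT.
have PZ : P Z = (fine (P Z))%:E by rewrite fineK// fin_num_measure.
apply/lee_addgt0Pr => e e0; rewrite add0e PZ lee_fin.
have [n hn] := ubd (e^-1)%R; have := no_event_le n.
have s0 : (0 < \sum_(i < n) p i)%R by rewrite (lt_le_trans _ hn)// invr_gt0.
rewrite /= PZ -!EFinM lee_fin -[leRHS]mulr1 ler_pM2l// mulrC -ler_pdivlMr// div1r.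
by move/le_trans; apply; rewrite -[e in leRHS]invrK lef_pV2// posrE// invr_gt0.
Qed.

End BorelCantelli.

(** * Shrinking targets at 0 that almost every orbit hits infinitely often *)

Section ShrinkingTargets.
Context {R : realType}.
Implicit Types (m k n : nat).
Local Notation nu := (circle_measure R).
Local Notation nu2 := (circle_measure R \x circle_measure R)%E.

(** For k >= 1 this is the j with 2^(j-1) <= k < 2^j; k = 0 also gets scale 1, so the scale is
    always positive. *)
Definition dyadic_scale k := (trunc_log 2 k).+1.

Lemma dyadic_scale_bound k : (k < 2 ^ dyadic_scale k)%N.
Proof. exact: trunc_log_ltn. Qed.

(** The factor j makes the lengths in one dyadic block add up to a multiple of 1/j, which still
    diverges; 4^m leaves a margin 2^m over the typical size 2^m j 2^j of the other sum. *)
Definition target m k : R :=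
  (4 ^+ m * (dyadic_scale k)%:R * 2 ^+ dyadic_scale k)^-1.

Lemma target_gt0 m k : 0 < target m k.
Proof. by rewrite invr_gt0 !mulr_gt0// exprn_gt0. Qed.

Lemma target_le1 m k : target m k <= 1.
Proof.
rewrite invf_le1; last by rewrite !mulr_gt0// exprn_gt0.
rewrite -!natrX -!natrM ler1n !muln_gt0 !expn_gt0 //.
Qed.

(** The block 2^N <= k < 2^(N+1) consists of 2^N equal lengths and contributes exactly the next
    harmonic term; only k = 0 is given away. *)
Lemma sum_target_dyadic m N :
  (2 * 4 ^+ m)^-1 * series harmonic N <= \sum_(0 <= k < 2 ^ N) target m k.
Proof.
elim: N => [|N IH].
  rewrite /series /= big_geq// mulr0; apply: sumr_ge0 => k _; exact/ltW/target_gt0.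
have leN : (2 ^ N <= 2 ^ N.+1)%N by rewrite leq_exp2l.
rewrite [leRHS](@big_cat_nat _ _ _ (2 ^ N))//= /series/= big_nat_recr//= mulrDr lerD//.
rewrite (eq_big_nat _ _ (F2 := fun=> (4 ^+ m * N.+1%:R * 2 ^+ N.+1)^-1)); last first.
  by move=> k kN; rewrite /target /dyadic_scale (trunc_log_eq _ kN).
rewrite sumr_const_nat expnS mul2n -addnn addnK -[leRHS]mulr_natr natrX exprS.
have p2 : 2 ^+ N != 0 :> R by rewrite expf_neq0.
have p4 : 4 ^+ m != 0 :> R by rewrite expf_neq0.
have pN : N.+1%:R != 0 :> R by [].
rewrite le_eqVlt; apply/orP; left; apply/eqP.
move: p2 p4 pN; move: (2 ^+ N) (4 ^+ m) (N.+1%:R : R) => a b c a0 b0 c0.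
by field; rewrite a0 b0 c0.
Qed.

(** The harmonic series is unbounded, and discarding the first k0 lengths costs only the constant
    [S0]. *)
Lemma sum_target_unbounded m k0 (M : R) :
  exists n, M <= \sum_(i < n) target m (k0 + i)%N.
Proof.
pose S0 := \sum_(0 <= k < k0) target m k.
have [N hN] : exists N, 2 * 4 ^+ m * (M + S0) <= series harmonic N :> R.
  apply: contrapT => /forallNP h; apply: (@dvg_harmonic R).
  apply: nondecreasing_is_cvgn.
    by apply/nondecreasing_seqP => n; rewrite /series /= big_nat_recr//= lerDl.
  exists (2 * 4 ^+ m * (M + S0)) => _ [n _ <-]; apply/ltW; rewrite ltNge.
  exact/negP/h.
exists (2 ^ N)%N.
have c0 : 0 < 2 * 4 ^+ m :> R by rewrite mulr_gt0// exprn_gt0.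
have : M + S0 <= \sum_(0 <= k < 2 ^ N) target m k.
  apply: le_trans (sum_target_dyadic m N).
  by rewrite mulrC ler_pdivlMr// mulrC.
have : \sum_(0 <= k < 2 ^ N) target m k <= \sum_(0 <= k < k0 + 2 ^ N) target m k.
  rewrite [leRHS](@big_cat_nat _ _ _ (2 ^ N))//= ?leq_addl// lerDl.
  by apply: sumr_ge0 => k _; exact/ltW/target_gt0.
rewrite [in X in X -> _](@big_cat_nat _ _ _ k0 0 (k0 + _))//= ?leq_addr// -/S0.
rewrite (_ : \sum_(k0 <= i < _) _ = \sum_(i < 2 ^ N) target m (k0 + i)%N); last first.
  rewrite -[X in \sum_(X <= _ < _) _]add0n big_addn addKn big_mkord.
  by apply: eq_bigr => i _; rewrite addnC.
by move=> h1 h2; have := le_trans h2 h1; rewrite (addrC M) lerD2l.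
Qed.

(** The point 0 is excluded because [phi] has the junk value 1 there, so landing on it would not
    make the sum large. *)
Definition target_hit m k : set (R * R) := orbit_in k `]0, target m k[%classic.

(** The exceptional set of Borel-Cantelli: off it, for every m the targets are hit at arbitrarily
    late times. *)
Definition target_missed : set (R * R) :=
  \bigcup_m \bigcup_k0 \bigcap_i ~` target_hit m (k0 + i).

Lemma measurable_target_hit m k : measurable (target_hit m k).
Proof. exact: measurable_orbit_in. Qed.

Lemma measurable_target_missed : measurable target_missed.
Proof.
apply: bigcupT_measurable => m; apply: bigcupT_measurable => k0.
by apply: bigcapT_measurable => i; apply: measurableC; exact: measurable_target_hit.
Qed.

Lemma circle_measure_target m k : nu `]0, target m k[%classic = (target m k)%:E.
Proof.
rewrite /circle_measure /mrestr (_ : _ `&` _ = `]0, target m k[%classic).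
  by rewrite lebesgue_measure_itv/= lte_fin target_gt0 -EFinD subr0.
apply/seteqP; split => x /=; rewrite !in_itv/=; first by case.
by have := target_le1 m k; lra.
Qed.

Lemma target_missed_null : nu2 target_missed = 0%E.
Proof.
apply/negligibleP; first exact: measurable_target_missed.
apply: negligible_bigcup => m; apply: negligible_bigcup => k0.
apply/negligibleP.
  by apply: bigcapT_measurable => i; apply: measurableC; exact: measurable_target_hit.
apply: (@pairwise_borel_cantelli _ _ _ nu2 (fun i => target_hit m (k0 + i))
  (fun i => target m (k0 + i)%N)).
- by move=> i; exact: measurable_target_hit.
- by move=> i; rewrite /= orbit_in_measure// circle_measure_target.
- move=> i j ij /=; rewrite orbit_in_indep ?ltn_add2l//.
  by rewrite !orbit_in_measure.
- exact: sum_target_unbounded.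
Qed.

End ShrinkingTargets.

(** * Birkhoff sums of phi: lower bound after a hit and upper tail bound *)

Section OrbitSums.
Context {R : realType}.
Implicit Types (x y al lam : R) (k l m n N j : nat).
Local Notation nu := (circle_measure R).

(** The Birkhoff sum with its iterates in closed form, 1-periodic in x and meaningful on the whole
    line. *)
Definition orbit_sum al N x : R := \sum_(k < N) phi (mod1 (x + k%:R * al)).

Lemma birkhoff_orbit_sum al N x : @circle R x ->
  birkhoff_sum (rotation al) (@phi R) N x = orbit_sum al N x.
Proof.
rewrite /circle /= in_itv /= => /andP[x0 x1]; apply: eq_bigr => k _.
by rewrite iter_rotation.
Qed.

Lemma orbit_sum_mod1 al N x : orbit_sum al N (mod1 x) = orbit_sum al N x.
Proof. by apply: eq_bigr => k _; rewrite mod1Dl. Qed.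

Lemma phi_mod1_gt0 x : 0 < phi (mod1 x).
Proof.
rewrite /phi ltr_wpDl ?invr_ge0 ?mod1_ge0// invr_gt0 subr_gt0.
exact: mod1_lt1.
Qed.

Lemma orbit_sum_ge0 al N x : 0 <= orbit_sum al N x.
Proof. by apply: sumr_ge0 => k _; exact/ltW/phi_mod1_gt0. Qed.

Lemma orbit_sum_gt0 al N x : (0 < N)%N -> 0 < orbit_sum al N x.
Proof.
case: N => // N _; rewrite /orbit_sum big_ord_recl ltr_pwDl ?phi_mod1_gt0//.
by apply: sumr_ge0 => k _; exact/ltW/phi_mod1_gt0.
Qed.

(** The term of index k alone is at least 1/d, and all terms are positive. *)
Lemma orbit_sum_hit al N x k (d : R) : (k < N)%N ->
  0 < mod1 (x + k%:R * al) < d -> d^-1 <= orbit_sum al N x.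
Proof.
move=> kN /andP[h0 hd]; rewrite /orbit_sum (bigD1 (Ordinal kN))//=.
rewrite ler_wpDr//; first by apply: sumr_ge0 => i _; exact/ltW/phi_mod1_gt0.
apply: (@le_trans _ _ (mod1 (x + k%:R * al))^-1).
  by rewrite lef_pV2 ?posrE ?ltW// (lt_trans h0).
by rewrite /phi lerDl invr_ge0 subr_ge0 ltW// mod1_lt1.
Qed.

Lemma measurable_phi_mod1 : measurable_fun setT (fun x => phi (mod1 x)).
Proof.
(* On nonnegative reals the inverse is the power with exponent -1, including at 0, where both are
   0. *)
rewrite (_ : (fun _ => _) =
    (fun x => powR (mod1 x) (-1) + powR (1 - mod1 x) (-1))); last first.
  by apply/funext => x; rewrite powR_inv1 ?mod1_ge0// powR_inv1// subr_ge0 ltW// mod1_lt1.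
have mp := @measurable_powR R (-1).
apply: measurable_funD; apply: (measurableT_comp mp); first exact: measurable_mod1.
by apply: measurable_funB => //; exact: measurable_mod1.
Qed.

Lemma measurable_orbit_sum N :
  measurable_fun setT (fun z : R * R => orbit_sum z.1 N z.2).
Proof.
apply: measurable_sum => k.
apply: (measurableT_comp measurable_phi_mod1).
by apply: measurable_funD => //; exact: measurable_funM.
Qed.

Lemma measurable_orbit_sum2 al N : measurable_fun setT (orbit_sum al N).
Proof.
apply: measurable_sum => k; apply: (measurableT_comp measurable_phi_mod1).
exact: measurable_funD.
Qed.

(** The arc of radius 2^-l about 0 in the circle, which is all of [0, 1) when l = 0. *)
Definition dyadic_nbhs l : set R :=
  [set y | 0 <= y < 1 /\ (y < (2 ^+ l)^-1 \/ 1 - y < (2 ^+ l)^-1)].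

Lemma dyadic_nbhsE l : dyadic_nbhs l =
  `[0, 1[ `&` (`[0, (2 ^+ l)^-1[ `|` `]1 - (2 ^+ l)^-1, 1[).
Proof.
apply/seteqP; split => y; rewrite /dyadic_nbhs /= !in_itv/=.
  move=> [/andP[h0 h1] [h|h]]; split; rewrite ?h0 ?h1//; [left|right] => //.
  by rewrite andbT; lra.
by move=> [/andP[h0 h1] [/andP[_ h]|/andP[h _]]];
  split; rewrite ?h0 ?h1//; [left|right; lra].
Qed.

Lemma measurable_dyadic_nbhs l : measurable (dyadic_nbhs l).
Proof. by rewrite dyadic_nbhsE; apply: measurableI => //; exact: measurableU. Qed.

Lemma dyadic_nbhs_measure l : (nu (dyadic_nbhs l) <= (2 / 2 ^+ l)%:E)%E.
Proof.
have d0 : 0 < (2 ^+ l)^-1 :> R by rewrite invr_gt0 exprn_gt0.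
rewrite /circle_measure /mrestr.
apply: (@le_trans _ _ (lebesgue_measure
    (`[0, (2 ^+ l)^-1[ `|` `]1 - (2 ^+ l)^-1, 1[ : set R))).
  apply: le_measure; rewrite ?inE; [|exact: measurableU|].
    by apply: measurableI => //; exact: measurable_dyadic_nbhs.
  by rewrite dyadic_nbhsE => y [] [_].
apply: (le_trans (measureU2 _ _ _)) => //=.
rewrite !lebesgue_measure_itv/= !lte_fin d0 ltrBlDr ltrDl d0 -!EFinB -EFinD lee_fin.
by lra.
Qed.

(** If i is the last level whose arc contains y, then y and 1 - y are at least 2^-(i+1), so phi y <=
    2^(i+2): the i-th term alone suffices. *)
Lemma phi_dyadic_le n y : 0 <= y < 1 -> ~ dyadic_nbhs n y ->
  phi y <= \sum_(l < n) 2 ^+ l.+2 * \1_(dyadic_nbhs l) y.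
Proof.
move=> y01 yn.
have {yn}[h1 h2] : (2 ^+ n)^-1 <= y /\ (2 ^+ n)^-1 <= 1 - y.
  by split; rewrite leNgt; apply/negP => h; apply: yn; split => //; [left|right].
have [i lin [yi hi1 hi2]] : exists2 i, (i < n)%N &
    [/\ dyadic_nbhs i y, (2 ^+ i.+1)^-1 <= y & (2 ^+ i.+1)^-1 <= 1 - y].
  elim: n h1 h2 => [|n IH] h1 h2; first by move: h1 h2; rewrite expr0 invr1; lra.
  have [yn|yn] := pselect (dyadic_nbhs n y); first by exists n.
  have [||i iN hi] := IH; last by exists i => //; exact: ltnW.
  - by rewrite leNgt; apply/negP => h; apply: yn; split => //; left.
  - by rewrite leNgt; apply/negP => h; apply: yn; split => //; right.
have p0 : 0 < (2 ^+ i.+1)^-1 :> R by rewrite invr_gt0 exprn_gt0.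
rewrite (bigD1 (Ordinal lin))//= indicE mem_set// mulr1 ler_wpDr//.
  by apply: sumr_ge0 => l _; rewrite mulr_ge0.
rewrite exprS mulrDl mul1r /phi lerD//.
  by rewrite -[leRHS]invrK lef_pV2// posrE// (lt_le_trans p0).
by rewrite -[leRHS]invrK lef_pV2// posrE// (lt_le_trans p0).
Qed.

(* Markov's inequality for the dyadic majorant of phi away from 0; the last
   coefficient 1 accounts for the orbits that visit [dyadic_nbhs n]. *)
Lemma orbit_sum_tail al N n lam : 0 < lam ->
  (nu [set x | (lam < orbit_sum al N x)%R] <=
    (N%:R * (8 * n%:R / lam + 2 / 2 ^+ n))%:E)%E.
Proof.
move=> lam0; set S := [set x | _].
have mS : measurable S.
  by rewrite -[S]setTI; apply: measurable_fun_ltr => //; exact: measurable_orbit_sum2.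
pose a l : R := if (l < n)%N then 2 ^+ l.+2 / lam else 1.
have a0 l : 0 <= a l by rewrite /a; case: ifP => // _; rewrite divr_ge0// ltW.
pose A k l := (fun x => mod1 (x + k%:R * al)) @^-1` dyadic_nbhs l.
have mA k l : measurable (A k l).
  rewrite -[A k l]setTI; have mf : measurable_fun setT (fun x => mod1 (x + k%:R * al)).
    by apply: measurableT_comp; [exact: measurable_mod1|exact: measurable_funD].
  by apply: mf => //; exact: measurable_dyadic_nbhs.
have -> : nu S = (\int[nu]_x (\1_S x)%:E)%E by rewrite integral_indic// setIT.
pose h x : R := \sum_(z : 'I_N * 'I_n.+1) a z.2 * \1_(A z.1 z.2) x.
have h0 x : 0 <= h x by apply: sumr_ge0 => z _; rewrite mulr_ge0.
apply: (@le_trans _ _ (\int[nu]_x (h x)%:E)%E).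
  apply: ge0_le_integral => //.
  - by apply/measurable_EFinP; exact: measurable_indic.
  - apply/measurable_EFinP/measurable_sum => z.
    apply: measurable_funM; first exact: measurable_cst.
    by apply: measurable_indic; exact: mA.
  - move=> x _; rewrite lee_fin indicE; have [/set_mem Sx|_] := boolP (x \in S);
      last exact: h0.
    rewrite /h -(pair_bigA _ (fun (k : 'I_N) (l : 'I_n.+1) => a l * \1_(A k l) x)) /=.
    (* Either some orbit point lies in the smallest arc, and its term alone is 1, or the dyadic
       majorant applies to every orbit point. *)
    have [[k kn]|none] := pselect (exists k : 'I_N, dyadic_nbhs n (mod1 (x + k%:R * al))).
      rewrite (bigD1 k)//= big_ord_recr/= indicE mem_set// mulr1 {2}/a ltnn.
      rewrite -addrA addrCA lerDl addr_ge0//; last apply: sumr_ge0 => ? _;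
        by apply: sumr_ge0 => ? _; rewrite mulr_ge0.
    rewrite -(ler_pM2l lam0) mulr1; apply: le_trans (ltW Sx) _; rewrite mulr_sumr.
    apply: ler_sum => k _.
    apply: (le_trans (@phi_dyadic_le n _ _ _)).
    + by rewrite mod1_ge0 mod1_lt1.
    + by move=> kn; apply: none; exists k.
    rewrite big_ord_recr/= mulrDr ler_wpDr//; first by rewrite !mulr_ge0// ltW.
    rewrite mulr_sumr; apply: ler_sum => l _.
    rewrite mulrA /a ltn_ord mulrCA divff ?gt_eqF// mulr1.
    by rewrite le_eqVlt; apply/orP; left; apply/eqP; rewrite !indicE.
rewrite integral_sum_indic//; last by move=> z; exact: mA.
rewrite -(pair_bigA _ (fun (k : 'I_N) (l : 'I_n.+1) => (a l)%:E * nu (A k l))%E) /=.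
apply: (@le_trans _ _ (\sum_(k < N) (8 * n%:R / lam + 2 / 2 ^+ n)%:E)%E); last first.
  by rewrite sumEFin lee_fin sumr_const card_ord [leRHS]mulr_natl.
apply: lee_sum => k _.
have le_l l : ((a l)%:E * nu (A k l) <= (a l * (2 / 2 ^+ l))%:E)%E.
  rewrite EFinM; apply: lee_wpmul2l; first by rewrite lee_fin.
  rewrite circle_measure_rotation; last exact: measurable_dyadic_nbhs.
  exact: dyadic_nbhs_measure.
apply: (@le_trans _ _ (\sum_(l < n.+1) (a l * (2 / 2 ^+ l))%:E)%E).
  by apply: lee_sum => l _; exact: le_l.
rewrite sumEFin lee_fin big_ord_recr/= {2}/a ltnn mul1r lerD2r.
(* The height 2^(l+2) and the arc length 2 / 2^l cancel, so each of the n levels costs the same. *)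
rewrite (eq_bigr (fun=> 8 / lam)); last first.
  move=> l _; rewrite /a ltn_ord !exprS.
  have : 2 ^+ l != 0 :> R by rewrite expf_neq0.
  move: (gt_eqF lam0) => /negbT; move: (2 ^+ l) => c l0 c0; field.
  by rewrite c0 l0.
by rewrite sumr_const card_ord mulrAC mulr_natr.
Qed.

(** Truncation at level j + m balances the two error terms: since j + m <= 2j they are at most 16 /
    2^m and 2 / 2^m. *)
Lemma orbit_sum_dyadic_tail al N m j : (N <= 2 ^ j)%N -> (0 < j)%N -> (m <= j)%N ->
  (nu [set x | (2 ^+ m * 2 ^+ j * j%:R < orbit_sum al N x)%R] <= (18 / 2 ^+ m)%:E)%E.
Proof.
move=> Nj j0 mj.
have jR : 0 < j%:R :> R by rewrite ltr0n.
have lam0 : 0 < 2 ^+ m * 2 ^+ j * j%:R :> R by rewrite !mulr_gt0// exprn_gt0.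
apply: (le_trans (@orbit_sum_tail al N (j + m) _ lam0)); rewrite lee_fin.
have p0 i : 0 < 2 ^+ i :> R by rewrite exprn_gt0.
apply: (@le_trans _ _ (2 ^+ j *
    (8 * (j + j)%:R / (2 ^+ m * 2 ^+ j * j%:R) + 2 / 2 ^+ (j + m)))).
  apply: ler_pM; [by []| |by rewrite -natrX ler_nat|].
    by apply: addr_ge0; apply: divr_ge0 => //; exact: ltW.
  by rewrite lerD2r ler_pM2r ?invr_gt0// ler_pM2l// ler_nat leq_add2l.
rewrite natrD exprD le_eqVlt; apply/orP; left; apply/eqP.
move: (p0 m) (p0 j) jR; move: (2 ^+ m) (2 ^+ j) (j%:R : R) => a b c a0 b0 c0.
by field; rewrite !gt_eqF.
Qed.

End OrbitSums.

(** A nonnegative function, here the measure of the section, has integral 0 exactly when it vanishes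
    almost everywhere. *)
Lemma product_measure1_eq0 d1 d2 (T1 : measurableType d1) (T2 : measurableType d2)
    (R : realType) (m1 : {measure set T1 -> \bar R})
    (m2 : {sigma_finite_measure set T2 -> \bar R}) (X : set (T1 * T2)) :
  measurable X ->
  ((m1 \x m2) X = 0)%E <-> {ae m1, forall x, m2 (xsection X x) = 0%E}.
Proof.
move=> mX; rewrite /product_measure1.
have mf : measurable_fun setT (m2 \o xsection X) by exact: measurable_fun_xsection.
have := ae_eq_integral_abs m1 measurableT mf.
under eq_integral do rewrite gee0_abs//.
move=> ->; split; apply: filterS => x /=; first exact.
by move=> + _.
Qed.

(** * Nullity of the triples with S_N(x) / S_N(y) bounded *)

Section Domination.
Context {R : realType}.
Implicit Types (x y al : R) (m n k : nat).
Local Notation nu := (circle_measure R).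
Local Notation nu2 := (circle_measure R \x circle_measure R)%E.

(** A bound m on S_N(x) / S_N(y) for all N >= n, cleared of the denominator, which vanishes at N =
    0. *)
Definition dominated_from al x m n : set R :=
  \bigcap_i [set y | orbit_sum al (n + i) x <= m%:R * orbit_sum al (n + i) y].

Lemma measurable_dominated_from al x m n : measurable (dominated_from al x m n).
Proof.
apply: bigcapT_measurable => i; set S := (X in measurable X).
rewrite -[S]setTI; apply: measurable_fun_ler => //.
by apply: measurable_funM => //; exact: measurable_orbit_sum2.
Qed.

(** When x hits the p-th target at a time k >= n of scale j, S_(k+1)(x) >= 4^p j 2^j. Domination
    with m < 2^p then forces S_(k+1)(y) > 2^p j 2^j, which the tail bound makes rare. *)
Lemma dominated_from_le al x m n p : ~ target_missed (al, x) -> (m <= p)%N ->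
  (nu (dominated_from al x m n) <= (18 / 2 ^+ p)%:E)%E.
Proof.
move=> hit mp.
(* Waiting until n + 2^p ensures both k >= n and j >= p, as the tail bound requires. *)
have [i hi] : exists i, target_hit p (n + 2 ^ p + i) (al, x).
  apply: contrapT => /forallNP h; apply: hit.
  by exists p => //; exists (n + 2 ^ p)%N => // i _; exact: h.
set k := (n + 2 ^ p + i)%N in hi; set j := dyadic_scale k.
have kj : (k < 2 ^ j)%N := dyadic_scale_bound k.
have pj : (p <= j)%N.
  rewrite -(@leq_exp2l 2)//; apply: leq_trans (ltnW kj).
  by rewrite /k addnAC leq_addl.
apply: (le_trans _ (@orbit_sum_dyadic_tail _ al k.+1 p j kj _ pj)) => //.
apply: le_measure; rewrite ?inE.
- exact: measurable_dominated_from.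
- set S := (X in measurable X); rewrite -[S]setTI.
  by apply: measurable_fun_ltr => //; exact: measurable_orbit_sum2.
(* The sum of length k + 1 is the first to contain the term of index k. *)
move=> y /(_ (2 ^ p + i).+1 I) /=; rewrite addnS addnA -/k => hy.
have := @orbit_sum_hit _ al k.+1 x k (target p k) (ltnSn k).
move: hi; rewrite /target_hit /orbit_in /= in_itv/= => /[swap] /[apply] hx.
rewrite ltNge; apply/negP => h.
have : 4 ^+ p * j%:R * 2 ^+ j <= m%:R * (2 ^+ p * 2 ^+ j * j%:R) :> R.
  move: hx; rewrite /target invrK => /le_trans; apply.
  by apply: (le_trans hy); rewrite ler_wpM2l.
have c0 : 0 < 2 ^+ p * 2 ^+ j * j%:R :> R by rewrite !mulr_gt0// exprn_gt0.
have -> : 4 ^+ p * j%:R * 2 ^+ j = 2 ^+ p * (2 ^+ p * 2 ^+ j * j%:R) :> R.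
  have -> : 4 = 2 * 2 :> R by ring.
  by rewrite exprMn; ring.
rewrite ler_pM2r// -natrX ler_nat leqNgt => /negP; apply.
by apply: leq_ltn_trans mp _; exact: ltn_expl.
Qed.

Lemma dominated_from_null al x m n : ~ target_missed (al, x) ->
  nu (dominated_from al x m n) = 0%E.
Proof.
move=> hit; apply/eqP; rewrite eq_le measure_ge0 andbT.
apply/lee_addgt0Pr => e e0; rewrite add0e.
(* This choice gives m <= p and 18 / e <= p < 2^p. *)
pose p := maxn m (Num.bound (18 / e)).
apply: (le_trans (@dominated_from_le al x m n p hit _)); first exact: leq_maxl.
rewrite lee_fin ler_pdivrMr ?exprn_gt0// mulrC -ler_pdivrMr//.
apply: (@le_trans _ _ (Num.bound (18 / e))%:R).
  by apply/ltW; apply: archi_boundP; rewrite divr_ge0// ltW.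
rewrite -natrX ler_nat (leq_trans (leq_maxr m _))// -/p.
exact/ltnW/ltn_expl.
Qed.

Definition dominated : set (R * R * R) :=
  \bigcup_m \bigcup_n [set z | dominated_from z.1.1 z.1.2 m n z.2].

Lemma measurable_dominated : measurable dominated.
Proof.
apply: bigcupT_measurable => m; apply: bigcupT_measurable => n.
set S := (X in measurable X).
have -> : S = \bigcap_i [set z : R * R * R |
    orbit_sum z.1.1 (n + i) z.1.2 <= m%:R * orbit_sum z.1.1 (n + i) z.2] by [].
apply: bigcapT_measurable => i; set U := (X in measurable X).
rewrite -[U]setTI; apply: measurable_fun_ler => //.
  by apply: (measurableT_comp (@measurable_orbit_sum R (n + i)) measurable_fst).
apply: measurable_funM => //.
have mp : measurable_fun setT (fun z : R * R * R => (z.1.1, z.2)).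
  by apply: measurable_fun_pair => //; exact: measurableT_comp.
exact: (measurableT_comp (@measurable_orbit_sum R (n + i)) mp).
Qed.

(** Over each (alpha, x) outside the null set [target_missed], the section in y is a countable union
    of null sets. *)
Lemma dominated_null : ((nu2 \x nu) dominated = 0)%E.
Proof.
apply/product_measure1_eq0; first exact: measurable_dominated.
have := @target_missed_null R => /negligibleP h.
apply: (negligibleS _ (h (measurable_target_missed))).
move=> [al x] /= hn; apply: contrapT => hit; apply: hn.
have -> : xsection dominated (al, x) =
    \bigcup_m \bigcup_n dominated_from al x m n.
  by apply/seteqP; split => y; rewrite /xsection /= inE.
apply/negligibleP.
  apply: bigcupT_measurable => m; apply: bigcupT_measurable => n.
  exact: measurable_dominated_from.
apply: negligible_bigcup => m; apply: negligible_bigcup => n.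
apply/negligibleP; first exact: measurable_dominated_from.
exact: dominated_from_null.
Qed.

End Domination.

(** * Criteria for the upper and lower limits, and exchange of factors *)

Lemma limn_esup_unbounded (R : realType) (u : nat -> R) :
  (forall m n : nat, exists2 N, (n <= N)%N & m%:R <= u N) ->
  limn_esup (EFin \o u) = +oo%E.
Proof.
move=> hu; rewrite limn_esup_lim.
have -> : esups (EFin \o u) = cst +oo%E; last exact: lim_cst.
apply/funext => n /=; apply/eqyP => A A0.
have [N nN hN] := hu (Num.bound A) n.
apply: (@le_trans _ _ (u N)%:E).
  by rewrite lee_fin; apply: le_trans hN; apply/ltW; exact/archi_boundP/ltW.
by apply: ereal_sup_ubound; exists N.
Qed.

Lemma limn_einf_vanishing (R : realType) (u : nat -> R) : (forall N, 0 <= u N) ->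
  (forall m n : nat, exists2 N, (n <= N)%N & u N <= m.+1%:R^-1) ->
  limn_einf (EFin \o u) = 0%E.
Proof.
move=> u0 hu; rewrite limn_einf_lim.
have -> : einfs (EFin \o u) = cst 0%E; last exact: lim_cst.
apply/funext => n /=; apply/eqP; rewrite eq_le; apply/andP; split; last first.
  by apply: le_ereal_inf_tmp => _ [N _ <-] /=; rewrite lee_fin.
apply/lee_addgt0Pr => e e0; rewrite add0e.
have [N nN hN] := hu (Num.bound e^-1) n.
apply: (@le_trans _ _ (u N)%:E); first by apply: ereal_inf_lbound; exists N.
rewrite lee_fin; apply: le_trans hN _.
rewrite -[leRHS]invrK lef_pV2 ?posrE ?invr_gt0//.
apply: (@le_trans _ _ (Num.bound e^-1)%:R); last by rewrite ler_nat.
by apply/ltW/archi_boundP; rewrite invr_ge0 ltW.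
Qed.

(** For each fixed first coordinate this is Fubini in the other two. It allows beta to vary with
    (alpha, x) fixed, although triples are ordered (alpha, beta, x). *)
Lemma product_measure_swap d1 d2 d3 (T1 : measurableType d1)
    (T2 : measurableType d2) (T3 : measurableType d3) (R : realType)
    (m1 : {sigma_finite_measure set T1 -> \bar R})
    (m2 : {sigma_finite_measure set T2 -> \bar R})
    (m3 : {sigma_finite_measure set T3 -> \bar R}) (V : set (T1 * T2 * T3)) :
  measurable V ->
  (((m1 \x m2) \x m3) V =
   ((m1 \x m3) \x m2) [set z | V ((z.1.1, z.2), z.1.2)])%E.
Proof.
move=> mV; set V' := [set z | _].
have mV' : measurable V'.
  have mf : measurable_fun setT (fun z : T1 * T3 * T2 => ((z.1.1, z.2), z.1.2)).
    apply: measurable_fun_pair; last exact: measurableT_comp.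
    by apply: measurable_fun_pair => //; exact: measurableT_comp.
  by rewrite -[V']setTI; exact: mf.
have mF := measurable_fun_xsection m3 mV.
have mF' := measurable_fun_xsection m2 mV'.
rewrite {1}/product_measure1 [RHS]/product_measure1.
rewrite fubini_tonelli1//= [RHS]fubini_tonelli1//=.
apply: eq_integral => a _; rewrite /fubini_F.
pose Va := [set p : T2 * T3 | V ((a, p.1), p.2)].
have mVa : measurable Va.
  have mf : measurable_fun setT (fun p : T2 * T3 => ((a, p.1), p.2)).
    by apply: measurable_fun_pair => //; exact: measurable_fun_pair.
  by rewrite -[Va]setTI; exact: mf.
have := @product_measure12 _ _ _ _ _ m2 m3 Va mVa.
rewrite /product_measure1 /product_measure2 => h.
transitivity (\int[m2]_x (m3 \o xsection Va) x)%E.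
  by apply: eq_integral.
by rewrite h; apply: eq_integral.
Qed.

(** * The substitution y = x - beta and the set of full measure *)

Section Assembly.
Context {R : realType}.
Implicit Types (x y al be : R) (m n k : nat).
Local Notation nu := (circle_measure R).
Local Notation nu2 := (circle_measure R \x circle_measure R)%E.
Local Notation leb := (@lebesgue_measure R).

Lemma not_dominated al x y m n : ~ dominated (al, x, y) ->
  exists2 N, (n <= N)%N & m%:R * orbit_sum al N y < orbit_sum al N x.
Proof.
move=> nd; apply: contrapT => h; apply: nd; exists m => //; exists n => // i _ /=.
rewrite leNgt; apply/negP => hi; apply: h; exists (n + i)%N => //.
exact: leq_addr.
Qed.

Lemma dominated_mod1 al x y : dominated (al, mod1 x, y) <-> dominated (al, x, y).
Proof.
split=> -[m _ [n _ h]]; exists m => //; exists n => // i _ /=;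
  by have := h i I; rewrite /= orbit_sum_mod1.
Qed.

Lemma circle_mod1 x : @circle R (mod1 x).
Proof. by rewrite /circle /= in_itv/= mod1_ge0 mod1_lt1. Qed.

Lemma Theta_orbit_sum al be N x : @circle R x ->
  Theta al be N x = orbit_sum al N x / orbit_sum al N (mod1 (x - be)).
Proof.
move=> cx; rewrite /Theta !birkhoff_orbit_sum//; exact: circle_mod1.
Qed.

Lemma limn_esup_Theta al be x : @circle R x ->
  ~ dominated (al, x, mod1 (x - be)) ->
  limn_esup (fun N => (Theta al be N x)%:E) = +oo%E.
Proof.
move=> cx nd; apply: limn_esup_unbounded => m n.
(* Asking for N > n makes the sum in the denominator nonempty, hence positive. *)
have [N nN hN] := @not_dominated _ _ _ m n.+1 nd.
exists N; first exact: ltnW.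
rewrite Theta_orbit_sum// ler_pdivlMr; first exact: ltW.
by apply: orbit_sum_gt0; exact: leq_trans nN.
Qed.

Lemma limn_einf_Theta al be x : @circle R x ->
  ~ dominated (al, mod1 (x - be), x) ->
  limn_einf (fun N => (Theta al be N x)%:E) = 0%E.
Proof.
move=> cx nd; apply: limn_einf_vanishing => [N|m n].
  by rewrite Theta_orbit_sum// divr_ge0// orbit_sum_ge0.
have [N nN hN] := @not_dominated _ _ _ m.+1 n.+1 nd.
exists N; first exact: ltnW.
rewrite Theta_orbit_sum// ler_pdivrMr; last first.
  by apply: orbit_sum_gt0; exact: leq_trans nN.
by rewrite mulrC ler_pdivlMr// mulrC; exact: ltW.
Qed.

Let measurable_mod1_comp d (T : measurableType d) (f : T -> R) :
  measurable_fun setT f -> measurable_fun setT (fun t => mod1 (f t)).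
Proof. exact: measurableT_comp measurable_mod1. Qed.

(** From here on triples are (alpha, beta, x), so that sections over (alpha, beta) are sets of x. *)
Definition fails_esup : set (R * R * R) :=
  [set z | dominated (z.1.1, z.2, mod1 (z.2 - z.1.2))].

(** The roles of x and x - beta are exchanged: off this set the inverse of [Theta] is unbounded. *)
Definition fails_einf : set (R * R * R) :=
  [set z | dominated (z.1.1, mod1 (z.2 - z.1.2), z.2)].

Let measurable_preimage_dominated (f : R * R * R -> R * R * R) :
  measurable_fun setT f -> measurable (f @^-1` dominated).
Proof.
move=> mf; rewrite -[X in measurable X]setTI; apply: mf => //.
exact: measurable_dominated.
Qed.

Let m11 : measurable_fun setT (fun z : R * R * R => z.1.1).
Proof. exact: measurableT_comp. Qed.

Let m12 : measurable_fun setT (fun z : R * R * R => z.1.2).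
Proof. exact: measurableT_comp. Qed.

Lemma measurable_fails_esup : measurable fails_esup.
Proof.
apply: (@measurable_preimage_dominated (fun z => (z.1.1, z.2, mod1 (z.2 - z.1.2)))).
apply: measurable_fun_pair; first exact: measurable_fun_pair.
by apply: measurable_mod1_comp; exact: measurable_funB.
Qed.

Lemma measurable_fails_einf : measurable fails_einf.
Proof.
apply: (@measurable_preimage_dominated (fun z => (z.1.1, mod1 (z.2 - z.1.2), z.2))).
apply: measurable_fun_pair => //; apply: measurable_fun_pair => //.
by apply: measurable_mod1_comp; exact: measurable_funB.
Qed.

(* For fixed (alpha, x) the point x - beta is uniform when beta is. *)
Lemma fails_esup_null : ((nu2 \x nu) fails_esup = 0)%E.
Proof.
rewrite product_measure_swap; last exact: measurable_fails_esup.
rewrite -[RHS](@dominated_null R); apply: eq_integral => -[al x] _ /=.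
rewrite -(@circle_measure_reflection _ x (xsection dominated (al, x))); last first.
  by apply: measurable_xsection; exact: measurable_dominated.
by congr (nu _); apply/seteqP; split => b; rewrite /xsection /= !inE.
Qed.

(** For fixed (alpha, beta), rotating x by beta turns the pair (x - beta, x) into (x, x + beta);
    then for fixed (alpha, x) the point x + beta is uniform when beta is. *)
Lemma fails_einf_null : ((nu2 \x nu) fails_einf = 0)%E.
Proof.
pose V := [set z : R * R * R | dominated (z.1.1, z.2, mod1 (z.2 + z.1.2))].
have mV : measurable V.
  apply: (@measurable_preimage_dominated (fun z => (z.1.1, z.2, mod1 (z.2 + z.1.2)))).
  apply: measurable_fun_pair; first exact: measurable_fun_pair.
  by apply: measurable_mod1_comp; exact: measurable_funD.
transitivity ((nu2 \x nu) V)%E.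
  apply: eq_integral => -[al be] _ /=.
  rewrite -(@circle_measure_rotation _ be (xsection fails_einf (al, be))); last first.
    by apply: measurable_xsection; exact: measurable_fails_einf.
  congr (nu _); apply/seteqP; split => y; rewrite /xsection /V /fails_einf /= !inE /=;
    by rewrite mod1Dl addrK dominated_mod1.
rewrite product_measure_swap// -[RHS](@dominated_null R).
apply: eq_integral => -[al x] _ /=.
rewrite -(@circle_measure_rotation _ x (xsection dominated (al, x))); last first.
  by apply: measurable_xsection; exact: measurable_dominated.
by congr (nu _); apply/seteqP; split => b; rewrite /xsection /= !inE /= addrC.
Qed.

(** Sections over points outside [0, 1) are empty, and the others lie in [0, 1), where the two
    measures agree. *)
Lemma product_measure_circle (X : set (R * R)) : measurable X ->
  X `<=` @circle R `*` @circle R -> (nu2 X = 0)%E -> ((leb \x leb) X = 0)%E.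
Proof.
move=> mX sX /product_measure1_eq0 => /(_ mX) [A [mA A0 hA]].
apply/product_measure1_eq0 => //; exists (A `&` `[0, 1[); split => //.
  exact: measurableI.
move=> x /= hx.
have cx : @circle R x.
  apply: contrapT => ncx; apply: hx; rewrite (_ : xsection X x = set0) ?measure0//.
  by apply/seteqP; split => // y; rewrite /xsection /= inE => /sX [].
split => //; apply: hA => /= h0; apply: hx; rewrite -[RHS]h0 /circle_measure /mrestr.
by congr (leb _); apply/esym/setIidPl => y; rewrite /xsection /= inE => /sX [].
Qed.

End Assembly.

Theorem proposition1p9 (R : realType) :
  exists Z : set (R * R),
    [/\ Z `<=` @circle R `*` @circle R,
        ((@lebesgue_measure R) \x (@lebesgue_measure R))%E.-negligible
          ((@circle R `*` @circle R) `\` Z)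
      & forall alpha beta : R, Z (alpha, beta) ->
          {ae @lebesgue_measure R, forall x : R, @circle R x ->
            limn_esup (fun N : nat => (Theta alpha beta N x)%:E) = +oo%E /\
            limn_einf (fun N : nat => (Theta alpha beta N x)%:E) = 0%E}].
Proof.
pose nu := circle_measure R.
pose F := @fails_esup R `|` @fails_einf R.
have mF : measurable F.
  by apply: measurableU; [exact: measurable_fails_esup|exact: measurable_fails_einf].
have F0 : (((nu \x nu) \x nu) F = 0)%E.
  apply/negligibleP => //; apply: negligibleU; apply/negligibleP.
  - exact: measurable_fails_esup.
  - exact: fails_esup_null.
  - exact: measurable_fails_einf.
  - exact: fails_einf_null.
pose C2 := @circle R `*` @circle R.
have mC2 : measurable C2 by apply: measurableX; exact: measurable_itv.
pose N := C2 `&` [set p | nu (xsection F p) != 0%E].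
have mN : measurable N.
  have mf := measurable_fun_xsection nu mF.
  apply: measurableI => //; set U := (X in measurable X).
  rewrite (_ : U = setT `&` (nu \o xsection F) @^-1` [set~ 0%E]).
    by apply: mf => //; exact: measurableC.
  by rewrite setTI; apply/seteqP; split => p /eqP.
have N0 : ((nu \x nu) N = 0)%E.
  apply/negligibleP => //.
  have /product_measure1_eq0 := F0 => /(_ mF).
  by apply: negligibleS => p [_ /eqP].
(* The pairs whose exceptional set of x is null; Fubini for [F] makes the remaining pairs a null
   set. *)
exists (C2 `&` [set p | nu (xsection F p) = 0%E]); split.
- by move=> p [].
- exists N; split => //; last first.
    by move=> p [Cp nZ]; split => //; apply/eqP => h; apply: nZ.
  apply: product_measure_circle => //; by move=> p [].
(* As [nu] is a restriction to [0, 1), [h] says that the section cut down to the circle is Lebesgue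
   null. *)
- move=> al be [_ /= h]; exists (xsection F (al, be) `&` @circle R); split.
  + by apply: measurableI; [exact: measurable_xsection|exact: measurable_itv].
  + exact: h.
  + move=> x /= /not_implyP[cx hx].
    have Fx : F (al, be, x).
      apply: contrapT => nF; apply: hx; split.
        by apply: limn_esup_Theta => // d; apply: nF; left.
      by apply: limn_einf_Theta => // d; apply: nF; right.
    by split => //; rewrite /xsection /= inE.
Qed.
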